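(* Let UH be scalar ($d_\alpha=1$) and nonparametric, let $\tau\in(0,1)$, and let $\phi(\eta_0)$ be the $\tau$-quantile of $\eta_0$, i.e. $\int_{-\infty}^{\phi(\eta_0)}d\eta_0(\alpha)=\tau$. Assume that $\eta_0$ is absolutely continuous with a strictly positive Lebesgue density $\dot\eta_0$ in a neighborhood of $\phi(\eta_0)$, and put $r_\phi(\alpha)=-\{1(\alpha<\phi(\eta_0))-\tau\}/\dot\eta_0(\phi(\eta_0))$. Let $N\subseteq\mathcal{A}$ be open and assume: (i) $\alpha\mapsto f_{z/\alpha}(z)$ is continuous on $N$ for $\mu$-a.e. $z$; (ii) for every $\alpha\in N$ there exists a neighborhood $\Gamma_0\subset N$ of $\alpha$ such that for all $s\in L_2^0(\mathbb{P})$ satisfying $r_\phi(\alpha)=\int s(z)f_{z/\alpha}(z)\,d\mu(z)$ ($\eta_0$-a.s.), $$\int|s(z)|\sup_{\alpha\in\Gamma_0}f_{z/\alpha}(z)\,d\mu(z)<\infty .$$ If $\phi(\eta_0)\in N$, then the $\tau$-quantile $\phi(\eta_0)$ of the nonparametric UH distribution is not regularly identified.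
   Context: Setting: $Z$ is observed; $\alpha$ (unobserved heterogeneity, UH) is unobserved with unknown distribution $\eta_0$ belonging to a class $H$ of distributions on $\mathcal{A}\subseteq\mathbb{R}^{d_\alpha}$, and $\mathcal{A}$ is the support of $\eta_0$. $Z$ has law $\mathbb{P}$ with density $f_{\eta_0}(z)=\int_{\mathcal{A}}f_{z/\alpha}(z)\,d\eta_0(\alpha)$ with respect to a $\sigma$-finite measure $\mu$, where $f_{z/\alpha}$ is the known conditional density of $Z$ given $\alpha$. $L_2^0(\nu)$ denotes the zero-$\nu$-mean functions in $L_2(\nu)$. Tangent space: a path $\eta_t\in H$, $t\in[0,\varepsilon)$, has score $b\in L_2(\eta_0)$ if $\int[(d\eta_t^{1/2}-d\eta_0^{1/2})/t-\tfrac12 b\,d\eta_0^{1/2}]^2\to0$ as $t\downarrow0$. $T(\eta_0)$ is the linear span of all such scores $b$. UH is nonparametric if $T(\eta_0)$ is dense in $L_2^0(\eta_0)$. Regular identification: the score operator is $Ab=\mathbb{E}[b(\alpha)\mid Z]$. A functional $\phi:H\to\mathbb{R}$ is differentiable with gradient (influence function) $r_\phi\in L_2^0(\eta_0)$ if $\lim_{t\to0}(\phi(\eta_t)-\phi(\eta_0))/t=\mathbb{E}_{\eta_0}[r_\phi(\alpha)b(\alpha)]$ along all such paths; the quantile functional is differentiable with the gradient $r_\phi$ displayed in the claim. The efficiency bound is $\sup_{b\in T(\eta_0)}(\mathbb{E}_{\eta_0}[r_\phi b])^2/\mathbb{E}[(Ab(Z))^2]$ (with $0/0=0$ and $c/0=\infty$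 for $c>0$). $\phi(\eta_0)$ is regularly identified if it is identified ($f_\eta=f_{\eta_0}$ $\mu$-a.e., $\eta\in H$, implies $\phi(\eta)=\phi(\eta_0)$) with a finite efficiency bound. *)

(* Defs.v *)
From HB Require Import structures.
From mathcomp Require Import all_boot all_order all_algebra.
From mathcomp Require Import all_classical all_reals all_analysis.

Set Implicit Arguments.
Unset Strict Implicit.
Unset Printing Implicit Defensive.

Import Order.TTheory GRing.Theory Num.Theory.
Import numFieldNormedType.Exports.

Local Open Scope classical_set_scope.
Local Open Scope ring_scope.

(* Distributions on the real line with its Borel sigma-algebra. *)
Notation distr R := (probability (measurableTypeR R) R).

Definition L2_0 d (T : measurableType d) (R : realType)
    (nu : probability T R) : set (T -> R) :=
  [set s | s \in Lfun nu 2%:E /\ (\int[nu]_x s x)%R = 0].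

Definition msupport (R : realType) (nu : distr R) : set R :=
  [set x | forall U : set R, open U -> U x -> (0 < nu U)%E].

(* The lower (generalized inverse) quantile.  It solves
   eta `]-oo, q] = tau whenever this equation is solvable, and it is defined
   for every distribution, so that it is a functional on any class H. *)
Definition quantile (R : realType) (tau : R) (eta : distr R) : R :=
  inf [set x : R | (tau%:E <= eta [set` `]-oo, x]])%E].

Definition is_density d (T : measurableType d) (R : realType)
    (nu : set T -> \bar R) (p : T -> R) (eta : set T -> \bar R) (D : set T) :=
  [/\ measurable_fun D p, (forall x, D x -> 0 <= p x) &
    forall B, measurable B -> B `<=` D ->
      eta B = (\int[nu]_(x in B) (p x)%:E)%E].

Section tangent.
Context (R : realType).
Implicit Types (H : set (distr R)) (eta : distr R) (b r : R -> R)
  (phi : distr R -> R).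

(* etat : t |-> eta_t is a path in H through eta0, defined for t in [0, eps),
   with score b.  The integral of
     [(d eta_t^(1/2) - d eta0^(1/2)) / t - b d eta0^(1/2) / 2]^2
   is computed from densities p t of eta_t and q t of eta0 with respect to a
   common dominating measure nu t; its value does not depend on the choice of
   nu t, p t and q t.  The measure nu t may vary with t because a path need
   not be dominated by a single sigma-finite measure. *)
Definition path_score H eta0 (etat : R -> distr R) b : Prop :=
  exists eps : R,
  [/\ 0 < eps, etat 0 = eta0,
      (forall t, 0 <= t < eps -> H (etat t)),
      b \in Lfun eta0 2%:E &
      exists (nu : R -> {sigma_finite_measure set (measurableTypeR R) -> \bar R})
             (p q : R -> R -> R),
        (forall t, 0 < t < eps ->
           is_density (nu t) (p t) (etat t) setT /\
           is_density (nu t) (q t) eta0 setT) /\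
        (\int[nu t]_x (((Num.sqrt (p t x) - Num.sqrt (q t x)) / t
                        - 2^-1 * b x * Num.sqrt (q t x)) ^+ 2)%:E)%E
          @[t --> (0 : R)^'+] --> (0 : \bar R)].

Definition score H eta0 : set (R -> R) :=
  [set b | exists etat, path_score H eta0 etat b].

Definition tangent_space H eta0 : set (R -> R) :=
  [set b | exists (n : nat) (c : 'I_n -> R) (s : 'I_n -> (R -> R)),
     (forall i, score H eta0 (s i)) /\ b = fun x => \sum_(i < n) c i * s i x].

Definition nonparametric H eta0 : Prop :=
  tangent_space H eta0 `<=` L2_0 eta0 /\
  forall h, L2_0 eta0 h -> forall e : R, 0 < e ->
    exists2 b, tangent_space H eta0 b &
      (Lnorm eta0 2%:E (fun x => (h x - b x)%:E) < e%:E)%E.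

Definition is_gradient H eta0 phi r : Prop :=
  L2_0 eta0 r /\
  forall etat b, path_score H eta0 etat b ->
    (phi (etat t) - phi eta0) / t @[t --> (0 : R)^'+]
      --> (\int[eta0]_a (r a * b a))%R.

End tangent.

Section model.
Context (R : realType) (dZ : measure_display) (Zt : measurableType dZ).
Implicit Types (mu : {sigma_finite_measure set Zt -> \bar R})
  (f : Zt -> R -> R) (A : set R) (H : set (distr R)) (eta : distr R).

Definition cond_density mu f A : Prop :=
  [/\ measurable_fun (setT `*` A)
        (fun u : Zt * measurableTypeR R => f u.1 u.2),
      (forall z a, A a -> 0 <= f z a) &
      forall a, A a -> (\int[mu]_z (f z a)%:E)%E = 1%E].

Definition mixture f A eta : Zt -> \bar R :=
  fun z => (\int[eta]_(a in A) (f z a)%:E)%E.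

Context (dO : measure_display) (Omega : measurableType dO).
Implicit Types (Pr : probability Omega R) (Z : {mfun Omega >-> Zt})
  (alpha : {mfun Omega >-> measurableTypeR R}).

(* alpha has distribution eta0 and, given alpha, Z has density f. *)
Definition uh_model Pr Z alpha mu f A eta0 : Prop :=
  (forall C, measurable C -> Pr (alpha @^-1` C) = eta0 C) /\
  forall B C, measurable B -> measurable C ->
    Pr (Z @^-1` B `&` alpha @^-1` C) =
      (\int[eta0]_(a in A `&` C) \int[mu]_(z in B) (f z a)%:E)%E.

(* g is a version of z |-> E[X | Z = z]. *)
Definition is_cond_exp Pr Z (X : Omega -> R) (g : Zt -> R) : Prop :=
  [/\ measurable_fun setT g,
      Pr.-integrable setT (fun w => (g (Z w))%:E) &
      forall B, measurable B ->
        (\int[Pr]_(w in Z @^-1` B) (g (Z w))%:E)%E =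
        (\int[Pr]_(w in Z @^-1` B) (X w)%:E)%E].

Definition is_score_operator Pr Z alpha (b : R -> R) (Ab : Zt -> R) : Prop :=
  is_cond_exp Pr Z (b \o alpha) Ab.

Local Open Scope ereal_scope.

Definition bound_ratio (n m : \bar R) : \bar R :=
  if m == 0 then (if n == 0 then 0 else +oo) else n / m.

Definition efficiency_bound Pr Z alpha H eta0 (r : R -> R) : \bar R :=
  ereal_sup [set x | exists (b : R -> R) (Ab : Zt -> R),
    [/\ tangent_space H eta0 b, is_score_operator Pr Z alpha b Ab &
      x = bound_ratio (((\int[eta0]_a (r a * b a))%R ^+ 2)%R)%:E
                      (\int[Pr]_w ((Ab (Z w)) ^+ 2)%:E)]].

Definition identified mu f A H eta0 (phi : distr R -> R) : Prop :=
  forall eta, H eta ->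
    {ae mu, forall z, mixture f A eta z = mixture f A eta0 z} ->
    phi eta = phi eta0.

Definition regularly_identified Pr Z alpha mu f A H eta0
    (phi : distr R -> R) : Prop :=
  identified mu f A H eta0 phi /\
  exists2 r, is_gradient H eta0 phi r &
    efficiency_bound Pr Z alpha H eta0 r < +oo.

End model.

(* r_phi, with q the quantile and p the Lebesgue density. *)
Definition quantile_gradient (R : realType) (tau q : R) (p : R -> R) : R -> R :=
  fun a => - ((a < q)%R%:R - tau) / p q.

(* Main.v *)
(* If the efficiency bound is finite, then E[r b]^2 <= C E[(A b)^2] for every
   b in the tangent space, so A b |-> E[r b] is a bounded linear functional,
   represented by some s in L2(P): E[s(Z) b(alpha)] = E[r b].  All gradients
   agree on the tangent space, and the tangent space is dense, so
   E[s(Z) | alpha] is the quantile gradient; hence it is the integral of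
   s f(., a) dmu for almost every a.  By domination this integral is continuous
   in a at the quantile q, whereas the quantile gradient jumps there by 1 / p q,
   and every neighborhood of q in N carries mass on both sides of q. *)

Require Import Defs.
From HB Require Import structures.
From mathcomp Require Import finmap.
From mathcomp Require Import all_boot all_order all_algebra.
From mathcomp Require Import all_classical all_reals all_analysis.
From mathcomp Require Import measurable_realfun.
From mathcomp Require Import ring lra.

Set Implicit Arguments.
Unset Strict Implicit.
Unset Printing Implicit Defensive.

Import Order.TTheory GRing.Theory Num.Theory.
Import numFieldNormedType.Exports.
Import HBNNSimple.

Local Open Scope classical_set_scope.
Local Open Scope ring_scope.

(** * The space L2 of a probability measure *)

(** The functional to be represented lives only on the images [A b] of tangent scores. This range
    need not be closed, several [b] may share one image, and each image is known only up to null
    sets. The convention [c/0 = +oo] settles the ambiguity: under a finite bound, [A b = 0] forces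
    [E[r b] = 0]. The Riesz argument is therefore run on the linear relation between images and
    values, without completing the range or choosing versions linearly. Two hypotheses concern
    centred functions only: tangent scores are dense among centred functions, and the domination is
    assumed for centred [s]. The representer is therefore recentred, which leaves its pairings with
    the centred tangent scores unchanged; its conditional expectation given [alpha] is then centred
    too. The resulting identity holds only almost everywhere and may fail at [q] itself, so it is
    read at points tending to [q] from each side. *)

Lemma quad_ge0_discr (R : realFieldType) (a b c : R) : 0 <= c ->
  (forall t, 0 <= a + 2 * t * b + t ^+ 2 * c) -> b ^+ 2 <= a * c.
Proof.
rewrite le_eqVlt => /predU1P[<- h|c0 h].
  suff -> : b = 0 by rewrite mulr0 expr0n.
  apply/eqP; apply: contraT => b0.
  (* With [c = 0] the quadratic is affine in [t], and a nonzero slope lets it reach -1. *)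
  have := h (- (a + 1) / (2 * b)).
  have -> : a + 2 * (- (a + 1) / (2 * b)) * b + (- (a + 1) / (2 * b)) ^+ 2 * 0
     = -1 by field.
  lra.
have := h (- b / c).
have -> : a + 2 * (- b / c) * b + (- b / c) ^+ 2 * c = (a * c - b ^+ 2) / c.
  by field; rewrite gt_eqF.
by rewrite pmulr_lge0 ?invr_gt0// subr_ge0.
Qed.

Section L2.
Context d (T : measurableType d) (R : realType) (nu : probability T R).
Implicit Types f g h : T -> R.

Local Notation L2 := (Lfun nu 2%:E).
Local Notation "''[' f , g ]" := (\int[nu]_x (f x * g x))%R.

Lemma Lfun2_measurable f : f \in L2 -> measurable_fun setT f.
Proof. by rewrite inE => /andP[]; rewrite inE. Qed.

Lemma Lfun2P f : measurable_fun setT f ->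
  (\int[nu]_x ((f x) ^+ 2)%:E < +oo)%E -> f \in L2.
Proof.
move=> mf foo; rewrite inE; apply/andP; split; rewrite inE//=.
rewrite /finite_norm unlock /Lnorm poweR_lty//.
apply: le_lt_trans foo; rewrite le_eqVlt; apply/orP; left; apply/eqP.
by apply: eq_integral => x _ /=; rewrite powR_mulrn// real_normK// num_real.
Qed.

Lemma Lfun2M_integrable f g : f \in L2 -> g \in L2 ->
  nu.-integrable setT (EFin \o (fun x => f x * g x)).
Proof. by move=> f2 g2; apply/Lfun1_integrable; exact: Lfun2_mul_Lfun1. Qed.

Lemma Lfun2_cst (c : R) : cst c \in L2.
Proof. exact: Lfun_cst. Qed.

Lemma Lfun2_lin f g (k : R) : f \in L2 -> g \in L2 ->
  (fun x => f x + k * g x) \in L2.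
Proof.
move=> f2 g2.
have l1 : (1 <= 2%:E :> \bar R)%E by rewrite lee_fin ler1n.
have [_ /(_ k g f g2 f2) kgf] := Lfun_submod_closed nu l1.
rewrite (_ : (fun x => _) = k *: (g : T -> R) + f)//.
by apply/funext => x; rewrite addrC.
Qed.

Lemma Lfun2B f g : f \in L2 -> g \in L2 -> (fun x => f x - g x) \in L2.
Proof.
move=> f2 g2; rewrite (_ : (fun x => _) = (fun x => f x + (-1) * g x)).
  exact: Lfun2_lin.
by apply/funext => x; rewrite mulN1r.
Qed.

Lemma Lfun2_integrable f : f \in L2 -> nu.-integrable setT (EFin \o f).
Proof.
move=> f2; apply/Lfun1_integrable; apply: Lfun_subset12 f2.
exact: fin_num_measure.
Qed.

Lemma L2ipC f g : '[f, g] = '[g, f].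
Proof. by apply: eq_Rintegral => x _; rewrite mulrC. Qed.

Lemma L2ip_linl f g h (k : R) : f \in L2 -> g \in L2 -> h \in L2 ->
  '[(fun x => f x + k * g x), h] = '[f, h] + k * '[g, h].
Proof.
move=> f2 g2 h2.
have ifh := Lfun2M_integrable f2 h2; have igh := Lfun2M_integrable g2 h2.
under eq_Rintegral do rewrite mulrDl -mulrA.
rewrite RintegralD//; last exact: (integrableZl measurableT _ igh).
by rewrite RintegralZl.
Qed.

Lemma L2ip_ge0 f : 0 <= '[f, f].
Proof. by apply: Rintegral_ge0 => x _; rewrite -expr2 sqr_ge0. Qed.

Lemma L2sq_integral f : f \in L2 ->
  (\int[nu]_x (f x ^+ 2)%:E = ('[f, f])%:E)%E.
Proof.
move=> f2; rewrite /Rintegral fineK; last first.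
  by rewrite fin_num_abs; have /integrableP[_ ] := Lfun2M_integrable f2 f2;
    apply: le_lt_trans; apply: le_abse_integral => //;
    have /integrableP[] := Lfun2M_integrable f2 f2.
by apply: eq_integral => x _; rewrite expr2.
Qed.

Lemma L2ip_sqD f g (k : R) : f \in L2 -> g \in L2 ->
  '[(fun x => f x + k * g x), (fun x => f x + k * g x)] =
  '[f, f] + 2 * k * '[f, g] + k ^+ 2 * '[g, g].
Proof.
move=> f2 g2; have fg2 := Lfun2_lin k f2 g2.
rewrite L2ip_linl// !['[_, (fun x => _ + _)]]L2ipC !L2ip_linl//.
rewrite (L2ipC g f); ring.
Qed.

Lemma L2_cauchy_schwarz f g : f \in L2 -> g \in L2 ->
  '[f, g] ^+ 2 <= '[f, f] * '[g, g].
Proof.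
move=> f2 g2; apply: quad_ge0_discr; first exact: L2ip_ge0.
by move=> t; rewrite -L2ip_sqD//; exact: L2ip_ge0.
Qed.

End L2.

(** * Completeness of L2 along rapidly Cauchy sequences *)

Section L2_complete.
Context d (T : measurableType d) (R : realType) (nu : probability T R).

Local Notation L2 := (Lfun nu 2%:E).
Local Notation "''[' f , g ]" := (\int[nu]_x (f x * g x))%R.

Lemma limn_einf_le (u : (\bar R)^nat) (b : \bar R) (n : nat) :
  (forall m, (n <= m)%N -> (u m <= b)%E) -> (limn_einf u <= b)%E.
Proof.
move=> ub; rewrite limn_einf_lim; apply: lime_le; first exact: is_cvg_einfs.
near=> m; rewrite /einfs/=; apply: (@le_trans _ _ (u m)); last first.
  by apply: ub; near: m; exact: nbhs_infty_ge.
by apply: ereal_inf_lbound; exists m => //=.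
Unshelve. all: by end_near. Qed.

(** Exchanging sum and integral makes the total variation of [v ^~ x] integrable in [x], hence
    finite almost everywhere; there the telescoping series converges absolutely. *)
Lemma ae_cvg_sum_abs_fin (v : nat -> T -> R) :
  (forall n, measurable_fun setT (v n)) ->
  (\sum_(0 <= n <oo) \int[nu]_x (`|v n.+1 x - v n x|)%:E < +oo)%E ->
  {ae nu, forall x, cvgn (v ^~ x)}.
Proof.
move=> mv sfin.
pose u n x : R := `|v n.+1 x - v n x|.
have mu_ n : measurable_fun setT (fun x => (u n x)%:E).
  apply/measurable_EFinP; apply: measurableT_comp => //.
  exact: measurable_funB.
have u0 n x : setT x -> (0 <= (u n x)%:E)%E.
  by move=> _ /=; rewrite lee_fin normr_ge0.
have iG : nu.-integrable setT (fun x => \sum_(0 <= n <oo) (u n x)%:E)%E.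
  apply/integrableP; split.
    apply: (@ge0_emeasurable_sum _ _ _ _ (fun n x => (u n x)%:E) xpredT) => //.
    by move=> n x _ _; exact: u0.
  rewrite (eq_integral (fun x => \sum_(0 <= n <oo) (u n x)%:E)%E); last first.
    by move=> x _; rewrite gee0_abs//; apply: nneseries_ge0 => n _ _; exact: u0.
  by rewrite (@integral_nneseries _ _ _ nu _ measurableT
    (fun n x => (u n x)%:E) mu_ u0).
have := integrable_ae measurableT iG.
apply: filterS => x /(_ Logic.I) Gx.
have : cvgn [normed series (fun n => v n.+1 x - v n x)].
  apply: nondecreasing_is_cvgn.
    by apply: nondecreasing_series => n _ _; exact: normr_ge0.
  exists (fine (\sum_(0 <= n <oo) (u n x)%:E)%E) => _ [n _ <-].
  rewrite -lee_fin fineK// /series/= -sumEFin.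
  by apply: nneseries_lim_ge => k _ _; rewrite lee_fin normr_ge0.
move/normed_cvg => cs.
rewrite (_ : v ^~ x =
  (fun n => series (fun n => v n.+1 x - v n x) n + v 0%N x)).
  by apply: is_cvgD => //; exact: is_cvg_cst.
apply/funext => n; rewrite /series/= telescope_sumr//; ring.
Qed.

(** A geometric rate makes the increments summable in L1, so the sequence itself converges almost
    everywhere and no subsequence is extracted. Fatou then transfers the rate to the limit. *)
Lemma L2_complete (v : nat -> T -> R) (K : R) : (forall n, v n \in L2) ->
  (forall n m, (n <= m)%N ->
    '[(fun x => v m x - v n x), (fun x => v m x - v n x)] <= K / 4 ^+ n) ->
  exists2 s, s \in L2 & forall n,
    '[(fun x => s x - v n x), (fun x => s x - v n x)] <= K / 4 ^+ n.
Proof.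
move=> v2 vC.
have mv n : measurable_fun setT (v n) by exact: Lfun2_measurable (v2 n).
have K0 : 0 <= K.
  have := vC _ _ (leqnn 0%N); rewrite expr0 divr1; apply: le_trans.
  exact: L2ip_ge0.
have cv : {ae nu, forall x, cvgn (v ^~ x)}.
  apply: ae_cvg_sum_abs_fin => //.
  (* An increment [w] satisfies [|w| <= 2^n w^2 + 2^-n], whose integral is at most [(K + 1) / 2^n]
     by [vC]; these bounds sum to [2 (K + 1)]. *)
  have e0 : (0 <= 2 * (K + 1)) by lra.
  apply: le_lt_trans (ltry (2 * (K + 1))).
  apply: le_trans (epsilon_trick0 xpredT e0).
  apply: lee_nneseries => [n _ _|n _].
    by apply: integral_ge0 => x _; rewrite lee_fin normr_ge0.
  have dv2 : (fun x => v n.+1 x - v n x) \in L2 by exact: Lfun2B.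
  have -> : ((2 * (K + 1) / (2 ^ n.+1)%:R)%:E =
    (2 ^+ n * (K / 4 ^+ n))%:E + (2 ^- n)%:E :> \bar R)%E.
    rewrite -EFinD natrX exprS (_ : 4 = 2 * 2 :> R) ?exprMn; last ring.
    by congr EFin; field; rewrite expf_neq0.
  apply: (@le_trans _ _ (\int[nu]_x ((2 ^+ n)%:E * ((v n.+1 x - v n x) ^+ 2)%:E
      + (2 ^- n)%:E))%E).
    apply: ge0_le_integral => //=.
    - apply/measurable_EFinP; apply: measurableT_comp => //.
      exact: measurable_funB.
    - apply/measurable_EFinP; apply: measurable_funD => //.
      apply: measurable_funM => //; apply: measurable_funX.
      exact: measurable_funB.
    - move=> x _; rewrite -EFinM -EFinD lee_fin.
      rewrite -[X in _ * X]real_normK ?num_real//.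
      set w := `|_ - _|; have p2 : 0 < 2 ^+ n :> R by rewrite exprn_gt0.
      (* Completing the square in [w]. *)
      rewrite -subr_ge0 (_ : (_ - _ : R) =
        2 ^+ n * (w - 2 ^- n / 2) ^+ 2 + 3 / 4 * 2 ^- n); last first.
        by field; rewrite gt_eqF.
      have p2V : 0 < 2 ^- n :> R by rewrite invr_gt0.
      apply: addr_ge0; first by rewrite mulr_ge0 ?sqr_ge0// ltW.
      by apply: mulr_ge0; lra.
  rewrite ge0_integralD//=; last first.
  - apply/measurable_EFinP; apply: measurable_funM => //.
    by apply: measurable_funX; exact: measurable_funB.
  - by move=> x _; rewrite -EFinM lee_fin mulr_ge0 ?sqr_ge0// exprn_ge0.
  have p0 : 0 <= 2 ^+ n :> R by rewrite exprn_ge0.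
  have mq : measurable_fun setT (fun x => ((v n.+1 x - v n x) ^+ 2)%:E).
    by apply/measurable_EFinP; apply: measurable_funX; exact: measurable_funB.
  have q0 x : setT x -> (0 <= ((v n.+1 x - v n x) ^+ 2)%:E)%E.
    by move=> _; rewrite lee_fin sqr_ge0.
  rewrite ge0_integralZl_EFin//.
  apply: leeD.
    rewrite L2sq_integral// EFinM lee_pmul2l ?lee_fin;
      [exact: vC|by rewrite fin_numE|].
    by rewrite lte_fin exprn_gt0.
  rewrite integral_cst// -[leRHS]mule1.
  apply: lee_wpmul2l; last exact: probability_le1.
  by rewrite lee_fin invr_ge0.
(* The upper limit is measurable and defined everywhere; it equals the limit wherever the sequence
   converges, and [fine] supplies a default value elsewhere. *)
pose s x : R := fine (limn_esup (fun n => (v n x)%:E)).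
have ms : measurable_fun setT s.
  apply: (measurableT_comp (fine_measurable measurableT)).
  by apply: measurable_fun_limn_esup => n; apply/measurable_EFinP.
have sv : {ae nu, forall x, v n x @[n --> \oo] --> s x}.
  apply: filterS cv => x vx.
  rewrite /s (_ : fine _ = limn (v ^~ x))//.
  have /cvg_limn_einf_sup[_ ->//] :
    (v n x)%:E @[n --> \oo] --> (limn (v ^~ x))%:E.
  by apply: cvg_EFin => //; exact: nearW.
(* Let [m] tend to infinity in [vC] with [n] fixed. The integrand is the lower limit only almost
   everywhere, whence the a.e. comparison before Fatou. *)
have bd n : (\int[nu]_x ((s x - v n x) ^+ 2)%:E <= (K / 4 ^+ n)%:E)%E.
  have msv m : measurable_fun setT (fun x => ((v m x - v n x) ^+ 2)%:E).
    by apply/measurable_EFinP; apply: measurable_funX; exact: measurable_funB.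
  apply: (@le_trans _ _
    (\int[nu]_x limn_einf (fun m => ((v m x - v n x) ^+ 2)%:E))%E).
    apply: ae_ge0_le_integral => //.
    - by move=> x _; rewrite lee_fin sqr_ge0.
    - by apply/measurable_EFinP; apply: measurable_funX; exact: measurable_funB.
    - move=> x _; rewrite limn_einf_lim.
      apply: lime_ge; first exact: is_cvg_einfs.
      near=> m; apply: le_ereal_inf_tmp => _ [k _ <-].
      by rewrite lee_fin sqr_ge0.
    - rewrite (_ : (fun x => _) =
        (fun x => - limn_esup (fun m => - ((v m x - v n x) ^+ 2)%:E))%E);
        last first.
        by apply/funext => x; rewrite /limn_einf.
      apply: measurableT_comp => //; apply: measurable_fun_limn_esup => m.
      exact: measurableT_comp.
    - apply: filterS sv => x svx _.
      have /cvg_limn_einf_sup[-> //] :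
        ((v m x - v n x) ^+ 2)%:E @[m --> \oo] --> ((s x - v n x) ^+ 2)%:E.
      apply: cvg_EFin; first exact: nearW.
      by apply: cvgM; apply: cvgB => //; exact: cvg_cst.
  apply: le_trans (fatou nu measurableT _ _) _ => //.
    by move=> m x _; rewrite lee_fin sqr_ge0.
  apply: (@limn_einf_le _ _ n) => m nm.
  by rewrite L2sq_integral ?lee_fin; [exact: vC|exact: Lfun2B].
have sv2 n : (fun x => s x - v n x) \in L2.
  apply: Lfun2P; first exact: measurable_funB.
  exact: le_lt_trans (bd n) (ltry _).
have s2 : s \in L2.
  rewrite (_ : s = (fun x => (s x - v 0%N x) + 1 * v 0%N x)).
    exact: Lfun2_lin.
  by apply/funext => x; rewrite mul1r subrK.
exists s => // n.
by rewrite -lee_fin -L2sq_integral.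
Unshelve. all: by end_near. Qed.

End L2_complete.

Lemma eq0_of_sqr_le_geometric (R : realType) (x B : R) :
  (forall n, x ^+ 2 <= B / 4 ^+ n) -> x = 0.
Proof.
move=> h; apply/eqP; rewrite -sqrf_eq0 eq_le sqr_ge0 andbT.
have cv : B / 4 ^+ n @[n --> \oo] --> (0 : R).
  rewrite -(mulr0 B); apply: cvgM; first exact: cvg_cst.
  under eq_fun do rewrite -exprVn.
  by apply: cvg_expr; rewrite ger0_norm ?invr_ge0// invf_lt1// ltr1n.
rewrite -(cvg_lim _ cv)//; apply: limr_ge; first by apply/cvg_ex; exists 0.
exact: nearW.
Qed.

Lemma sqr_le_bounds (R : realDomainType) (x y : R) : 0 <= y ->
  x ^+ 2 <= y ^+ 2 -> - y <= x <= y.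
Proof.
by move=> y0 xy; rewrite -ler_norml -ler_sqr ?nnegrE// real_normK ?num_real.
Qed.

(** * Riesz representation by minimization *)

Section L2_riesz.
Context d (T : measurableType d) (R : realType) (nu : probability T R).

Local Notation L2 := (Lfun nu 2%:E).
Local Notation "''[' f , g ]" := (\int[nu]_x (f x * g x))%R.

(* G is the graph of a functional that need only be well defined up to null
   sets, which avoids quotienting L2 and choosing versions linearly.  The
   representer is the limit of a sequence minimizing '[v, v] - 2 c over G. *)
Lemma L2_riesz (G : (T -> R) -> R -> Prop) (C : R) :
  0 <= C -> (forall v c, G v c -> v \in L2) -> G (cst 0) 0 ->
  (forall v c w e k, G v c -> G w e ->
    G (fun x => v x + k * w x) (c + k * e)) ->
  (forall v c, G v c -> c ^+ 2 <= C * '[v, v]) ->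
  exists2 s, s \in L2 & forall v c, G v c -> '[s, v] = c.
Proof.
move=> C0 GL G0 Glin GC.
pose J := [set y : R | exists v c, G v c /\ y = '[v, v] - 2 * c].
have J0 : J !=set0 by eexists; exists (cst 0), 0; split.
have JC : lbound J (- C).
  move=> _ [v [c [Gvc ->]]]; have := GC _ _ Gvc; have := L2ip_ge0 nu v.
  set q := '[v, v] => q0 cq; rewrite lerNl opprB lerBlDr.
  (* From [c^2 <= C q] and [4 C q <= (C + q)^2]. *)
  have : (2 * c) ^+ 2 <= (C + q) ^+ 2.
    have := sqr_ge0 (C - q); nra.
  by move=> /(sqr_le_bounds (addr_ge0 C0 q0))/andP[_].
have hiJ : has_inf J by split=> //; exists (- C).
have J_ge v c : G v c -> inf J <= '[v, v] - 2 * c.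
  by move=> Gvc; apply: ge_inf; [exists (- C)|exists v, c].
have /choice[vc vcP] : forall n, exists vc : (T -> R) * R, G vc.1 vc.2 /\
    '[vc.1, vc.1] - 2 * vc.2 <= inf J + 1 / 4 ^+ n.
  move=> n; have e0 : 0 < 1 / 4 ^+ n :> R by rewrite divr_gt0 ?exprn_gt0.
  have [_ [v [c [Gvc ->]]] /ltW vcJ] := inf_adherent e0 hiJ.
  by exists (v, c).
(* Approximate stationarity: moving by [t w] lowers the objective by at most [1 / 4^n], so a
   quadratic in [t] is nonnegative and its discriminant gives the bound. *)
have var n w e : G w e ->
    ('[(vc n).1, w] - e) ^+ 2 <= 1 / 4 ^+ n * '[w, w].
  move=> Gwe; have [Gn Jn] := vcP n.
  apply: quad_ge0_discr; first exact: L2ip_ge0.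
  move=> t; have := J_ge _ _ (Glin _ _ _ _ t Gn Gwe).
  rewrite L2ip_sqD ?(GL _ _ Gn) ?(GL _ _ Gwe)//; move: Jn; lra.
(* Write [u = v_m - v_n], [q = '[u, u]] and [e = 1 / 4^n]. Expanding the objective at [v_m] around
   [v_n] gives [q <= e + |2 (y - d)|], where [y = '[v_n, u]] and [d] is the difference of the
   values. By [var], [|2 (y - d)| <= 2 e + q / 2], so [q <= 6 e]. *)
have [||s s2 sP] := @L2_complete _ _ _ nu (fun n => (vc n).1) 6.
- by move=> n; have [/GL] := vcP n.
- move=> n m nm; have [Gn Jn] := vcP n; have [Gm Jm] := vcP m.
  have Gu := Glin _ _ _ _ (-1) Gm Gn.
  have uE : (fun x => (vc m).1 x - (vc n).1 x) =
      (fun x => (vc m).1 x + -1 * (vc n).1 x).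
    by apply/funext => x; rewrite mulN1r.
  rewrite -uE in Gu; set u := (fun x => _) in uE Gu; have := var n _ _ Gu.
  have u2 := GL _ _ Gu.
  have mE : (vc m).1 = (fun x => (vc n).1 x + 1 * u x).
    by apply/funext => x; rewrite /u; ring.
  have Jmn : '[(vc m).1, (vc m).1] = '[(vc n).1, (vc n).1] +
      2 * '[(vc n).1, u] + '[u, u].
    by rewrite [in LHS]mE L2ip_sqD ?(GL _ _ Gn)// expr1n mulr1 mul1r.
  have Jinf := J_ge _ _ Gn.
  have em : 1 / 4 ^+ m <= 1 / 4 ^+ n :> R.
    by rewrite !div1r lef_pV2 ?posrE ?exprn_gt0// ler_eXn2l// ltr1n.
  have e0 : 0 < 1 / 4 ^+ n :> R by rewrite divr_gt0 ?exprn_gt0.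
  have q0 := L2ip_ge0 nu u.
  rewrite (_ : 6 / 4 ^+ n = 6 * (1 / 4 ^+ n)); last by rewrite mulrA mulr1.
  move: Jm Jn; rewrite Jmn.
  move: (1 / 4 ^+ m) (1 / 4 ^+ n) em e0 q0 Jinf => em en emn en0.
  move: ('[u, u]) ('[(vc n).1, u]) ('[(vc n).1, (vc n).1]).
  move: (vc m).2 (vc n).2 (inf J).
  move=> cm cn i q y z q0 iz Jm Jn yq.
  have : (2 * (y - (cm + -1 * cn))) ^+ 2 <= (2 * en + q / 2) ^+ 2.
    apply: (@le_trans _ _ (4 * (en * q))).
      have -> : (2 * (y - (cm + -1 * cn))) ^+ 2 = 4 * (y - (cm + -1 * cn)) ^+ 2.
        by ring.
      apply: ler_wpM2l; [lra|exact: yq].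
    rewrite -subr_ge0 (_ : _ - _ = (2 * en - q / 2) ^+ 2); last by field.
    exact: sqr_ge0.
  have enq : 0 <= 2 * en + q / 2 by lra.
  by move=> hsq; have /andP[h1 h2] := sqr_le_bounds enq hsq; lra.
exists s => // w e Gwe; apply/eqP; rewrite -subr_eq0; apply/eqP.
(* The error splits as [a + (b - e)], whose square is at most [2 a^2 + 2 (b - e)^2]. The rates 6
   (completeness) and 1 ([var]) give [14 = 2 * 6 + 2 * 1]. *)
apply: (@eq0_of_sqr_le_geometric _ _ (14 * '[w, w])) => n.
have [Gn _] := vcP n; have w2 := GL _ _ Gwe; have n2 := GL _ _ Gn.
have sn2 := Lfun2B s2 n2.
pose a := '[(fun x => s x - (vc n).1 x), w]; pose b := '[(vc n).1, w].
have -> : '[s, w] = a + b.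
  rewrite /b -[X in _ + X]mul1r -L2ip_linl//; apply: eq_Rintegral => x _.
  by rewrite mul1r subrK.
have h1 : a ^+ 2 <= _ := L2_cauchy_schwarz sn2 w2.
have h2 : (b - e) ^+ 2 <= _ := var n _ _ Gwe.
have h3 : '[(fun x => s x - (vc n).1 x), (fun x => s x - (vc n).1 x)] * '[w, w]
  <= 6 / 4 ^+ n * '[w, w] by apply: ler_wpM2r; [exact: L2ip_ge0|exact: sP].
have {h1 h3}h1 := le_trans h1 h3.
rewrite (_ : 14 * _ / _ =
  2 * (6 / 4 ^+ n * '[w, w]) + 2 * (1 / 4 ^+ n * '[w, w])); last first.
  by field; rewrite expf_neq0.
apply: (@le_trans _ _ (2 * a ^+ 2 + 2 * (b - e) ^+ 2)); last first.
  by apply: lerD; rewrite ler_pM2l.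
rewrite -subr_ge0 (_ : _ - _ = (a - (b - e)) ^+ 2); [exact: sqr_ge0|ring].
Qed.

End L2_riesz.

(** * Laws and conditional expectations *)

Definition has_law dO (Omega : measurableType dO) d (T : measurableType d)
    (R : realType) (Pr : probability Omega R) (X : {mfun Omega >-> T})
    (nu : probability T R) :=
  forall B, measurable B -> Pr (X @^-1` B) = nu B.

Section law.
Context dO (Omega : measurableType dO) d (T : measurableType d) (R : realType).
Variables (Pr : probability Omega R) (X : {mfun Omega >-> T})
  (nu : probability T R).
Hypothesis Xnu : has_law Pr X nu.

Lemma ge0_law_integral (f : T -> \bar R) (D : set T) : measurable D ->
  measurable_fun setT f -> (forall x, 0 <= f x)%E ->
  (\int[nu]_(x in D) f x = \int[Pr]_(w in X @^-1` D) f (X w))%E.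
Proof.
move=> mD mf f0.
rewrite -(@ge0_integral_pushforward _ _ _ _ _ X
  (@measurable_funPT _ _ _ _ X) Pr D f)//; last exact: measurable_funTS.
apply: eq_measure_integral => B mB _.
exact/esym/Xnu.
Qed.

Lemma Lfun2_law f : f \in Lfun nu 2%:E -> f \o X \in Lfun Pr 2%:E.
Proof.
move=> f2; have mf := Lfun2_measurable f2.
apply: Lfun2P; first exact: measurableT_comp.
have := @ge0_law_integral (fun x => (f x ^+ 2)%:E) setT measurableT.
rewrite preimage_setT => <-.
- by rewrite L2sq_integral// ltry.
- by apply/measurable_EFinP; exact: measurable_funX.
- by move=> x; rewrite lee_fin sqr_ge0.
Qed.

Lemma law_integral f D : measurable D -> measurable_fun setT f ->
  (\int[nu]_(x in D) (f x)%:E = \int[Pr]_(w in X @^-1` D) (f (X w))%:E)%E.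
Proof.
move=> mD mf; rewrite integralE [RHS]integralE.
have mfE : measurable_fun setT (EFin \o f) by apply/measurable_EFinP.
congr (_ - _)%E.
  rewrite (ge0_law_integral mD (measurable_funepos mfE))//.
  by apply: eq_integral => w _; rewrite !funeposE.
rewrite (ge0_law_integral mD (measurable_funeneg mfE))//.
by apply: eq_integral => w _; rewrite !funenegE.
Qed.

Lemma law_Rintegral f : measurable_fun setT f ->
  (\int[nu]_x f x = \int[Pr]_w f (X w))%R.
Proof. by move=> mf; rewrite /Rintegral law_integral// preimage_setT. Qed.

End law.

(** The version of [E[b(Y) | X]] is the Riesz representer of [h |-> E[h(X) b(Y)]], bounded by
    Cauchy-Schwarz. It serves in both directions: conditioning on [Z] for the scores, and on [alpha]
    for the representer. *)
Lemma condexp_L2 dO (Omega : measurableType dO) d1 (T1 : measurableType d1)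
    d2 (T2 : measurableType d2) (R : realType) (Pr : probability Omega R)
    (X : {mfun Omega >-> T1}) (Y : {mfun Omega >-> T2})
    (nu1 : probability T1 R) (nu2 : probability T2 R) :
  has_law Pr X nu1 -> has_law Pr Y nu2 ->
  forall b, b \in Lfun nu2 2%:E ->
  exists2 g, g \in Lfun nu1 2%:E & forall h, h \in Lfun nu1 2%:E ->
    (\int[nu1]_x (g x * h x) = \int[Pr]_w (h (X w) * b (Y w)))%R.
Proof.
move=> X1 Y2 b b2; have bY2 := Lfun2_law Y2 b2.
pose ip (f g : Omega -> R) := (\int[Pr]_w (f w * g w))%R.
have [|||||g g2 gP] := @L2_riesz _ _ _ nu1
    (fun v c => v \in Lfun nu1 2%:E /\ c = ip (v \o X) (b \o Y))
    (ip (b \o Y) (b \o Y)).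
- exact: L2ip_ge0.
- by move=> v c [].
- split; first exact: Lfun2_cst.
  rewrite /ip; under eq_Rintegral do rewrite mul0r.
  by rewrite Rintegral_cst// mul0r.
- move=> v c w e k [v2 ->] [w2 ->]; split; first exact: Lfun2_lin.
  by rewrite /ip -L2ip_linl//; exact: (Lfun2_law X1).
- move=> v c [v2 ->]; rewrite mulrC (law_Rintegral X1); last first.
    by apply: measurable_funM; exact: Lfun2_measurable v2.
  by apply: L2_cauchy_schwarz => //; exact: (Lfun2_law X1).
by exists g => // h h2; apply: gP.
Qed.

(** * Joint laws with a conditional density *)

(** The usual passage from indicators through simple functions to monotone limits, packaged as an
    induction principle. *)
Lemma ge0_measurable_ind d (T : measurableType d) (R : realType)
    (P : (T -> \bar R) -> Prop) :
  (forall B, measurable B -> P (fun x => (\1_B x)%:E)) ->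
  (forall (k : R) g, 0 <= k -> measurable_fun setT g ->
    (forall x, 0 <= g x)%E -> P g -> P (fun x => k%:E * g x)%E) ->
  (forall g h, measurable_fun setT g -> measurable_fun setT h ->
    (forall x, 0 <= g x)%E -> (forall x, 0 <= h x)%E -> P g -> P h ->
    P (fun x => g x + h x)%E) ->
  (forall g : nat -> T -> \bar R, (forall n, measurable_fun setT (g n)) ->
    (forall n x, 0 <= g n x)%E -> (forall x, nondecreasing_seq (g^~ x)) ->
    (forall n, P (g n)) -> P (fun x => limn (g^~ x))) ->
  forall f, measurable_fun setT f -> (forall x, 0 <= f x)%E -> P f.
Proof.
move=> Pind PZ PD Plim f mf f0.
pose g := nnsfun_approx measurableT mf.
rewrite (_ : f = fun x => limn (fun n => (g n x)%:E)); last first.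
  by apply/funext => x; apply/esym/cvg_lim => //; exact: cvg_nnsfun_approx.
apply: (Plim (fun n x => (g n x)%:E)).
- by move=> n; apply/measurable_EFinP.
- by move=> n x; rewrite lee_fin.
- by move=> x m n mn; rewrite lee_fin; exact/lefP/nd_nnsfun_approx.
move=> n.
pose G r x : \bar R := (r%:E * (\1_(g n @^-1` [set r]) x)%:E)%E.
have G0 r x : 0 <= r -> (0 <= G r x)%E by move=> r0; rewrite mule_ge0 ?lee_fin.
have mG r : measurable_fun setT (G r).
  rewrite /G; under eq_fun do rewrite -EFinM.
  by apply/measurable_EFinP; exact: measurable_funM.
have PG r : 0 <= r -> P (G r).
  by move=> r0; apply: PZ => //; [exact/measurable_EFinP|exact: Pind].
have PS (s : seq R) : (forall r, r \in s -> 0 <= r) ->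
    P (fun x => \sum_(r <- s) G r x)%E.
  elim: s => [_|r s IH rs0].
    (* The empty sum is presented as zero times an indicator, a form that the closure hypotheses
       cover. *)
    rewrite (_ : (fun x => _) = (fun x => 0%:E * (\1_(@setT T) x)%:E)%E).
      apply: PZ => //; [exact/measurable_EFinP|exact: Pind].
    by apply/funext => x; rewrite big_nil mul0e.
  have r0 : 0 <= r by apply: rs0; rewrite mem_head.
  have s0 t : t \in s -> 0 <= t by move=> ts; apply: rs0; rewrite inE ts orbT.
  rewrite (_ : (fun x => _) =
    (fun x => G r x + \sum_(t <- s) G t x)%E); last first.
    by apply/funext => x; rewrite big_cons.
  apply: PD => //;
    [exact: emeasurable_sum|by move=> x; exact: G0| |exact: PG|exact: IH].
  by move=> x; rewrite big_seq; apply: sume_ge0 => t /s0; exact: G0.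
rewrite (_ : (fun x => _) =
    (fun x : T => \sum_(r <- (fset_set (range (g n)) : seq R)) G r x)%E).
  by apply: PS => r; rewrite in_fset_set//= => /set_mem[y _ <-].
by apply/funext => x; rewrite fimfunE fsbig_finite//= sumEFin.
Qed.

Section joint.
Context dO (Omega : measurableType dO) d1 (T1 : measurableType d1)
  d2 (T2 : measurableType d2) (R : realType).
Variables (Pr : probability Omega R) (X : {mfun Omega >-> T1})
  (Y : {mfun Omega >-> T2}) (mu : {sigma_finite_measure set T1 -> \bar R})
  (nu : probability T2 R) (F : T1 * T2 -> R).
Hypotheses (mF : measurable_fun setT F) (F0 : forall u, 0 <= F u).
Hypothesis XY : forall B C, measurable B -> measurable C ->
  Pr (X @^-1` B `&` Y @^-1` C) =
    (\int[nu]_(y in C) \int[mu]_(x in B) (F (x, y))%:E)%E.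

Lemma measurable_section (h : T1 -> \bar R) y :
  measurable_fun setT h -> measurable_fun setT (fun x => h x * (F (x, y))%:E)%E.
Proof.
move=> mh; apply: emeasurable_funM => //.
apply/measurable_EFinP; apply: measurableT_comp mF _.
exact: pair2_measurable.
Qed.

Lemma measurable_inner (h : T1 -> \bar R) :
  measurable_fun setT h -> (forall x, 0 <= h x)%E ->
  measurable_fun setT (fun y => \int[mu]_x (h x * (F (x, y))%:E))%E.
Proof.
move=> mh h0.
apply: (@measurable_fun_fubini_tonelli_G _ _ T1 T2 R mu
  (fun u => h u.1 * (F u)%:E)%E).
- apply: emeasurable_funM; first exact: measurableT_comp.
  exact/measurable_EFinP.
- by move=> u; rewrite mule_ge0 ?lee_fin.
Qed.

(** The integrand depends on [X] alone and the event on [Y] alone, so with [C] fixed the induction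
    on [h] starts from the rectangles of [XY]; no joint law on the product is constructed. *)
Lemma ge0_joint_integral (h : T1 -> \bar R) (C : set T2) : measurable C ->
  measurable_fun setT h -> (forall x, 0 <= h x)%E ->
  (\int[Pr]_(w in Y @^-1` C) h (X w) =
   \int[nu]_(y in C) \int[mu]_x (h x * (F (x, y))%:E))%E.
Proof.
move=> mC; have mYC : measurable (Y @^-1` C) by exact: measurable_funPTI.
have mX (g : T1 -> \bar R) : measurable_fun setT g ->
    measurable_fun (Y @^-1` C) (fun w => g (X w)).
  by move=> mg; apply: measurable_funTS; exact: measurableT_comp.
move: h; apply: (@ge0_measurable_ind _ T1 R (fun h =>
  \int[Pr]_(w in Y @^-1` C) h (X w) =
  \int[nu]_(y in C) \int[mu]_x (h x * (F (x, y))%:E))%E).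
- move=> B mB.
  have mXB : measurable (X @^-1` B) by exact: measurable_funPTI.
  transitivity (Pr (X @^-1` B `&` Y @^-1` C)).
    rewrite (_ : (fun w => _) = (fun w => (\1_(X @^-1` B) w)%:E))//.
    by rewrite integral_indic.
  rewrite XY//; apply: eq_integral => y _.
  rewrite integral_mkcond; apply: eq_integral => x _.
  by rewrite patchE indicE; case: ifPn => _; rewrite ?mul1e ?mul0e.
- move=> k g k0 mg g0 IH.
  rewrite ge0_integralZl_EFin//; last exact: mX.
  rewrite IH -ge0_integralZl_EFin//; last first.
  + exact/measurable_funTS/measurable_inner.
  + by move=> y _; apply: integral_ge0 => x _; rewrite mule_ge0 ?lee_fin.
  apply: eq_integral => y _; rewrite -ge0_integralZl_EFin//.
  + by apply: eq_integral => x _; rewrite muleA.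
  + by move=> x _; rewrite mule_ge0 ?lee_fin.
  + exact: measurable_section.
- move=> g h mg mh g0 h0 IHg IHh.
  rewrite ge0_integralD//; [|exact: mX|exact: mX].
  rewrite IHg IHh -ge0_integralD//; last 4 first.
  + by move=> y _; apply: integral_ge0 => x _; rewrite mule_ge0 ?lee_fin.
  + exact/measurable_funTS/measurable_inner.
  + by move=> y _; apply: integral_ge0 => x _; rewrite mule_ge0 ?lee_fin.
  + exact/measurable_funTS/measurable_inner.
  apply: eq_integral => y _; rewrite -ge0_integralD//; last 4 first.
  + by move=> x _; rewrite mule_ge0 ?lee_fin.
  + exact: measurable_section.
  + by move=> x _; rewrite mule_ge0 ?lee_fin.
  + exact: measurable_section.
  by apply: eq_integral => x _; rewrite ge0_muleDl.
- move=> g mg g0 ndg IH.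
  rewrite (@monotone_convergence _ _ _ _ _ mYC (fun n w => g n (X w))
    (fun n => mX _ (mg n)) (fun n w _ => g0 n (X w)) (fun w _ => ndg (X w))).
  under eq_fun do rewrite IH.
  have gF0 n y x : (0 <= g n x * (F (x, y))%:E)%E by rewrite mule_ge0 ?lee_fin.
  have ndgF y x : nondecreasing_seq (fun n => g n x * (F (x, y))%:E)%E.
    by move=> m n mn; rewrite lee_wpmul2r ?lee_fin//; exact: ndg.
  rewrite -(@monotone_convergence _ _ _ nu _ mC
    (fun n y => \int[mu]_x (g n x * (F (x, y))%:E))%E); last 3 first.
  + by move=> n; exact/measurable_funTS/measurable_inner.
  + by move=> n y _; apply: integral_ge0 => x _; exact: gF0.
  + move=> y _ m n mn; apply: ge0_le_integral => //.
    * exact: measurable_section.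
    * exact: measurable_section.
    * by move=> x _; exact: ndgF.
  apply: eq_integral => y _.
  rewrite -(@monotone_convergence _ _ _ mu _ measurableT
    (fun n x => g n x * (F (x, y))%:E)%E
    (fun n => measurable_section y (mg n)) (fun n x _ => gF0 n y x)
    (fun x _ => ndgF y x)).
  apply: eq_integral => x _.
  under eq_fun do rewrite muleC.
  by rewrite limeMl// ?fin_numE// 1?muleC//; apply: ereal_nondecreasing_is_cvgn.
Qed.

End joint.

Lemma Lfun2_indic d (T : measurableType d) (R : realType)
  (nu : probability T R) (E : set T) : measurable E -> \1_E \in Lfun nu 2%:E.
Proof.
move=> mE; apply: Lfun2P => //.
rewrite (eq_integral (fun x => (\1_E x)%:E)); last first.
  by move=> x _; rewrite indicE; case: (_ \in _); rewrite /= ?expr1n// expr0n.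
by rewrite integral_indic// setIT (le_lt_trans (probability_le1 _ _))// ltry.
Qed.

Lemma Rintegral_mul_indic d (T : measurableType d) (R : realType)
    (nu : {measure set T -> \bar R}) (f : T -> R) (E : set T) : measurable E ->
  nu.-integrable setT (EFin \o f) ->
  (\int[nu]_x (f x * \1_E x))%R%:E = (\int[nu]_(x in E) (f x)%:E)%E.
Proof.
move=> mE fi.
have -> : (\int[nu]_x (f x * \1_E x))%R = (\int[nu]_(x in E) f x)%R.
  rewrite [RHS]Rintegral_mkcond; apply: eq_Rintegral => x _.
  by rewrite patchE indicE; case: ifPn; rewrite ?mulr1 ?mulr0.
rewrite /Rintegral fineK//; apply: integrable_fin_num => //.
exact: integrableS fi.
Qed.

Section condexp_density.
Context dO (Omega : measurableType dO) d1 (T1 : measurableType d1)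
  d2 (T2 : measurableType d2) (R : realType).
Variables (Pr : probability Omega R) (X : {mfun Omega >-> T1})
  (Y : {mfun Omega >-> T2}) (mu : {sigma_finite_measure set T1 -> \bar R})
  (nu : probability T2 R) (F : T1 * T2 -> R).
Hypotheses (mF : measurable_fun setT F) (F0 : forall u, 0 <= F u).
Hypothesis XY : forall B C, measurable B -> measurable C ->
  Pr (X @^-1` B `&` Y @^-1` C) =
    (\int[nu]_(y in C) \int[mu]_(x in B) (F (x, y))%:E)%E.

(** Testing [k] against indicators of events in [Y] and disintegrating the two parts of [s]
    separately identifies [k] with the integral against the density. *)
Lemma condexp_density (s : T1 -> R) (k : T2 -> R) :
  measurable_fun setT s -> s \o X \in Lfun Pr 2%:E -> k \in Lfun nu 2%:E ->
  (forall h, h \in Lfun nu 2%:E ->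
    \int[nu]_y (k y * h y) = \int[Pr]_w (h (Y w) * s (X w)))%R ->
  {ae nu, forall y, (k y)%:E = \int[mu]_x (s x * F (x, y))%:E}%E.
Proof.
move=> ms sX2 k2 kP.
have sXi := Lfun2_integrable sX2.
have mYC C : measurable C -> measurable (Y @^-1` C).
  by move=> mC; rewrite -[X in measurable X]setTI; exact: measurable_funP.
have msE : measurable_fun setT (EFin \o s) by exact/measurable_EFinP.
pose sp x := ((EFin \o s)^\+ x)%E; pose sn x := ((EFin \o s)^\- x)%E.
have msp : measurable_fun setT sp by exact: measurable_funepos.
have msn : measurable_fun setT sn by exact: measurable_funeneg.
have sp0 x : (0 <= sp x)%E by exact: funepos_ge0.
have sn0 x : (0 <= sn x)%E by exact: funeneg_ge0.
pose I (h : T1 -> \bar R) y := (\int[mu]_x (h x * (F (x, y))%:E))%E.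
(* Integrating [I h] over [nu] gives [E[h(X)]], at most [E|s(X)|]. Hence the difference of the two
   parts is meaningful almost everywhere. *)
have Ifin (h : T1 -> \bar R) : measurable_fun setT h ->
    (forall x, 0 <= h x)%E ->
    (forall x, h x <= `|(s x)%:E|)%E -> nu.-integrable setT (I h).
  move=> mh h0 hs; apply/integrableP; split; first exact: measurable_inner.
  rewrite (eq_integral (I h)); last first.
    move=> y _; rewrite gee0_abs//; apply: integral_ge0 => x _.
    by rewrite mule_ge0 ?lee_fin.
  rewrite -(ge0_joint_integral mF F0 XY measurableT mh h0) preimage_setT.
  have /integrableP[_] := sXi; apply: le_lt_trans.
  apply: ge0_le_integral => //.
  - exact: measurableT_comp.
  - by apply: measurableT_comp => //; exact: measurableT_comp msE _.
have Isp : nu.-integrable setT (I sp).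
  apply: Ifin => // x; rewrite /sp funeposE/= /maxe.
  by case: ifPn => [_|_]; rewrite lee_fin ?normr_ge0// ler_norm.
have Isn : nu.-integrable setT (I sn).
  apply: Ifin => // x; rewrite /sn funenegE/= /maxe.
  by case: ifPn => [_|_]; rewrite lee_fin ?normr_ge0// -normrN ler_norm.
have : ae_eq nu setT (EFin \o k) (fun y => I sp y - I sn y)%E.
  apply: integral_ae_eq => //.
  - exact: Lfun2_integrable.
  - by apply: emeasurable_funB; exact: measurable_inner.
  move=> E _ mE; rewrite -Rintegral_mul_indic//; last exact: Lfun2_integrable.
  rewrite kP; last exact: Lfun2_indic.
  have -> : (\int[Pr]_w (\1_E (Y w) * s (X w)) =
      \int[Pr]_w ((s \o X) w * \1_(Y @^-1` E) w))%R.
    by apply: eq_Rintegral => w _; rewrite mulrC.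
  rewrite Rintegral_mul_indic//; last exact: mYC.
  rewrite integralB//; [|exact: integrableS Isp|exact: integrableS Isn].
  rewrite -!(ge0_joint_integral mF F0 XY mE)// integralE.
  by congr (_ - _)%E; apply: eq_integral => w _;
    rewrite /sp /sn ?funeposE ?funenegE.
apply: filterS => y /(_ Logic.I) /= ->.
(* Since [F] is nonnegative, multiplying by it commutes with taking positive and negative parts. *)
rewrite [RHS]integralE; congr (_ - _)%E; apply: eq_integral => x _.
- rewrite /sp !funeposE/= EFinM; have := F0 (x, y); rewrite -lee_fin => F0'.
  by rewrite maxe_pMl// mul0e.
- rewrite /sn !funenegE/= -mulNr EFinM.
  have := F0 (x, y); rewrite -lee_fin => F0'.
  by rewrite maxe_pMl// mul0e.
Qed.

End condexp_density.

(** * Continuity under a local domination *)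

(** Taken straight from the supremum over simple functions, so that it covers a right-hand side
    whose measurability is unknown, such as the supremum over [Gamma]. *)
Lemma ge0_le_integralT d (T : measurableType d) (R : realType)
    (mu : {measure set T -> \bar R}) (f g : T -> \bar R) :
  (forall x, 0 <= f x)%E -> (forall x, f x <= g x)%E ->
  (\int[mu]_x f x <= \int[mu]_x g x)%E.
Proof.
move=> f0 fg; have g0 x : (0 <= g x)%E by exact: le_trans (fg x).
rewrite !ge0_integralTE//; apply: le_ereal_sup => _ [h hf <-].
by exists h => // x; exact: le_trans (fg x).
Qed.

Section jump.
Context (R : realType) d (T : measurableType d)
  (mu : {sigma_finite_measure set T -> \bar R}).
Variables (f : T -> R -> R) (N Gamma : set R) (q : R) (s : T -> R).
Hypotheses (mf : forall a, N a -> measurable_fun setT (f^~ a))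
  (f0 : forall z a, N a -> 0 <= f z a) (oN : open N)
  (fc : {ae mu, forall z, {within N, continuous (f z)}})
  (nG : nbhs q Gamma) (GN : Gamma `<=` N) (ms : measurable_fun setT s)
  (sG : (\int[mu]_z
    (`|s z|%:E * ereal_sup [set (f z a)%:E | a in Gamma]) < +oo)%E).

Lemma dominated_cvg_section (a_ : nat -> R) : (forall n, Gamma (a_ n)) ->
  a_ n @[n --> \oo] --> q ->
  (\int[mu]_z (s z * f z (a_ n))%:E)%E @[n --> \oo] -->
    (\int[mu]_z (s z * f z q)%:E)%E.
Proof.
move=> Ga aq; have Nq : N q by apply: GN; exact: nbhs_singleton.
have Na n : N (a_ n) by apply: GN.
(* The supremum over Gamma need not be measurable in z; the one along the
   sequence is. *)
pose g z : \bar R := (`|s z|%:E * esups (fun n => (f z (a_ n))%:E) 0%N)%E.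
have fle z n : ((f z (a_ n))%:E <= esups (fun n => (f z (a_ n))%:E) 0%N)%E.
  by apply: ereal_sup_ubound; exists n.
have g0 z : (0 <= g z)%E.
  rewrite mule_ge0 ?lee_fin//; apply: le_trans (fle z 0%N).
  by rewrite lee_fin; exact: f0.
have mg : measurable_fun setT g.
  apply: emeasurable_funM.
    by apply/measurable_EFinP; exact: measurableT_comp.
  by apply: measurable_fun_esups => n; apply/measurable_EFinP; exact: mf.
have ig : mu.-integrable setT g.
  apply/integrableP; split => //.
  rewrite (eq_integral g); last by move=> z _; rewrite gee0_abs.
  apply: le_lt_trans sG; apply: ge0_le_integralT => // z.
  apply: lee_wpmul2l; first by rewrite lee_fin.
  by apply: le_ereal_sup => _ [n _ <-]; exists (a_ n).
have msf a : N a -> measurable_fun setT (fun z => (s z * f z a)%:E).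
  by move=> Naa; apply/measurable_EFinP/measurable_funM => //; exact: mf.
have [|||_ _ h] := @dominated_convergence _ _ _ mu setT measurableT
  (fun n z => (s z * f z (a_ n))%:E) (fun z => (s z * f z q)%:E) g
  (fun n => msf _ (Na n)) (msf _ Nq).
- apply: filterS fc => z; rewrite continuous_open_subspace// => fz _.
  apply: cvg_EFin; first exact: nearW.
  apply: cvgM; first exact: cvg_cst.
  by apply: (cvg_comp _ _ aq); apply: fz; rewrite inE.
- exact: ig.
- apply: nearW => z n _; rewrite /= normrM EFinM /g.
  by apply: lee_wpmul2l; rewrite ?lee_fin// ger0_norm//; exact: f0.
- exact: h.
Qed.

End jump.

(** An open set around a support point has positive mass, so it cannot lie inside a null set. *)
Lemma ae_in_open (R : realType) (eta : distr R) (P : R -> Prop) (U : set R) x :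
  {ae eta, forall a, P a} -> open U -> U x -> msupport eta x ->
  exists2 a, U a & P a.
Proof.
move=> [B [mB B0 PB]] oU Ux sx; apply: contrapT => UP.
have := sx U oU Ux; suff -> : eta U = 0%E by rewrite ltxx.
apply/eqP; rewrite eq_le measure_ge0 andbT -B0.
apply: le_measure; rewrite ?inE//; first exact: open_measurable.
by move=> a Ua; apply: PB => Pa; apply: UP; exists a.
Qed.

Lemma closed_msupport (R : realType) (eta : distr R) : closed (msupport eta).
Proof.
move=> x cx U oU Ux.
have [y [sy Uy]] := cx U (open_nbhs_nbhs (conj oU Ux)).
exact: sy.
Qed.

(** The open sets [U n] shrink to [q] without having to contain it. Each holds a point where the
    a.e. identity is valid; along these points the integral is constantly [c], and by domination it
    tends to its value at [q]. One-sided intervals turn this into one-sided limits. *)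
Lemma locally_constant_limit (R : realType) d (T : measurableType d)
    (mu : {sigma_finite_measure set T -> \bar R}) (f : T -> R -> R)
    (N Gamma : set R) (q : R) (s : T -> R) (eta : distr R) (r : R -> R)
    (c e : R) (U : nat -> set R) :
  (forall a, N a -> measurable_fun setT (f^~ a)) ->
  (forall z a, N a -> 0 <= f z a) -> open N ->
  {ae mu, forall z, {within N, continuous (f z)}} ->
  nbhs q Gamma -> Gamma `<=` N -> measurable_fun setT s ->
  (\int[mu]_z (`|s z|%:E * ereal_sup [set (f z a)%:E | a in Gamma]) < +oo)%E ->
  N `<=` msupport eta ->
  {ae eta, forall a, (r a)%:E = \int[mu]_z (s z * f z a)%:E}%E ->
  (forall n, open (U n)) -> (forall n, U n !=set0) ->
  (forall n, U n `<=` ball q (e / n.+1%:R)) -> (forall n, U n `<=` Gamma) ->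
  (forall n a, U n a -> r a = c) ->
  c%:E = (\int[mu]_z (s z * f z q)%:E)%E.
Proof.
move=> mf f0 oN fc nG GN ms sG Nsupp ae_r oU U0 Ub UG Uc.
have /choice[a_ aP] : forall n, exists a, U n a /\
    (r a)%:E = (\int[mu]_z (s z * f z a)%:E)%E.
  move=> n; have [x Ux] := U0 n.
  have [a Ua ra] := ae_in_open ae_r (oU n) Ux (Nsupp _ (GN _ (UG n _ Ux))).
  by exists a.
have aq : a_ n @[n --> \oo] --> q.
  apply/cvgrPdist_lt => eps eps0; near=> n.
  have [Ua _] := aP n; have := Ub _ _ Ua; rewrite -ball_normE /=.
  move=> /lt_trans; apply; near: n.
  have : e * @harmonic R n @[n --> \oo] --> (0 : R).
    by rewrite -(mulr0 e); apply: cvgM; [exact: cvg_cst|exact: cvg_harmonic].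
  move/cvgrPdist_lt => /(_ _ eps0); apply: filterS => n.
  by rewrite sub0r normrN; apply: le_lt_trans; exact: ler_norm.
have := dominated_cvg_section mf f0 oN fc nG GN ms sG
  (fun n => UG n _ (aP n).1) aq.
have -> : (fun n => \int[mu]_z (s z * f z (a_ n))%:E)%E = (fun=> c%:E).
  by apply/funext => n; have [Ua <-] := aP n; rewrite (Uc n).
by move=> /(cvg_unique _ (cvg_cst _)); apply.
Unshelve. all: by end_near. Qed.

(** * Tangent spaces and gradients *)

Section tangent_space_theory.
Context (R : realType) (H : set (distr R)) (eta : distr R).
Local Notation L2 := (Lfun eta 2%:E).
Local Notation "''[' f , g ]" := (\int[eta]_x (f x * g x))%R.

Lemma tangent_space0 : tangent_space H eta (cst 0).
Proof.
exists 0%N, (fun=> 0), (fun=> cst 0); split => [[]//|].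
by apply/funext => x; rewrite big_ord0.
Qed.

Lemma tangent_space_lin b b' (k : R) : tangent_space H eta b ->
  tangent_space H eta b' -> tangent_space H eta (fun x => b x + k * b' x).
Proof.
move=> [n [c [s [sS ->]]]] [m [c' [s' [s'S ->]]]].
exists (n + m)%N,
  (fun i => match fintype.split i with inl j => c j | inr j => k * c' j end),
  (fun i => match fintype.split i with inl j => s j | inr j => s' j end); split.
  by move=> i; case: (fintype.split i).
apply/funext => x; rewrite big_split_ord/=; congr (_ + _).
  apply: eq_bigr => i _; case: splitP => [j /= /val_inj ->//|j /= ij].
  by move: (ltn_ord i); rewrite ij -ltn_subRL subnn ltn0.
rewrite mulr_sumr; apply: eq_bigr => i _.
case: splitP => [j /= ji|j /= /addnI/val_inj ->].
  by move: (ltn_ord j); rewrite -ji -ltn_subRL subnn ltn0.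
by rewrite mulrA.
Qed.

Lemma score_Lfun2 b : score H eta b -> b \in L2.
Proof. by move=> [etat [eps []]]. Qed.

(** Along one path both pairings are the limit of the same difference quotient; linearity extends
    the equality from scores to their span. *)
Lemma gradient_unique phi r r' : is_gradient H eta phi r ->
  is_gradient H eta phi r' ->
  forall b, tangent_space H eta b -> '[r, b] = '[r', b].
Proof.
move=> [[r2 _] rP] [[r'2 _] r'P] _ [n [c [s [sS ->]]]].
have sr i : '[r, s i] = '[r', s i].
  have [etat etatP] := sS i.
  exact: cvg_unique (rP _ _ etatP) (r'P _ _ etatP).
(* Partial sums over a list let the induction carry membership in L2, which additivity of the
   pairing requires. *)
pose S (l : seq 'I_n) (x : R) := \sum_(i <- l) c i * s i x.
suff : forall l, S l \in L2 /\ '[S l, r] = '[S l, r'].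
  by move=> /(_ (index_enum _))[_]; rewrite L2ipC => ->; rewrite L2ipC.
elim=> [|i l [l2 lP]].
  have -> : S [::] = cst 0 by apply/funext => x; rewrite /S big_nil.
  by split; [exact: Lfun2_cst|apply: eq_Rintegral => x _; rewrite !mul0r].
have -> : S (i :: l) = (fun x => S l x + c i * s i x).
  by apply/funext => x; rewrite /S big_cons addrC.
have si2 := score_Lfun2 (sS i).
split; first exact: Lfun2_lin.
by rewrite !L2ip_linl// lP !['[s i, _]]L2ipC sr.
Qed.

Lemma Lnorm2E f : f \in L2 ->
  Lnorm eta 2%:E (EFin \o f) = (Num.sqrt '[f, f])%:E.
Proof.
move=> f2; rewrite unlock /Lnorm.
rewrite (eq_integral (fun x => (f x ^+ 2)%:E)); last first.
  by move=> x _ /=; rewrite powR_mulrn// real_normK// num_real.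
by rewrite L2sq_integral// poweR_EFin powR12_sqrt// L2ip_ge0.
Qed.

Lemma L2ip_eq0_ae f : f \in L2 -> '[f, f] = 0 -> {ae eta, forall x, f x = 0}.
Proof.
move=> f2 ff0; have mf := Lfun2_measurable f2.
have msq : measurable_fun setT (fun x => (f x ^+ 2)%:E).
  by apply/measurable_EFinP; exact: measurable_funX.
have [+ _] := ae_eq_integral_abs eta measurableT msq.
have -> : (\int[eta]_x `|(f x ^+ 2)%:E|)%E = 0%E.
  rewrite -[RHS]/(0%:E) -ff0 -L2sq_integral//; apply: eq_integral => x _.
  by rewrite gee0_abs// lee_fin sqr_ge0.
move=> /(_ erefl); apply: filterS => x /(_ Logic.I) /= [] /eqP.
by rewrite sqrf_eq0 => /eqP.
Qed.

Lemma nonparametric_orthogonal f : nonparametric H eta -> L2_0 eta f ->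
  (forall b, tangent_space H eta b -> '[f, b] = 0) ->
  {ae eta, forall x, f x = 0}.
Proof.
move=> [TL2 dense] f20 fT; have [f2 _] := f20; apply: L2ip_eq0_ae => //.
apply/eqP; rewrite eq_le L2ip_ge0 andbT leNgt; apply/negP => q0.
(* For [b] orthogonal to [f], ['[f - b, f] = '[f, f]], so Cauchy-Schwarz makes the squared distance
   from [f] to [b] at least ['[f, f]]. A radius whose square is half of that contradicts density. *)
have e0 : 0 < Num.sqrt ('[f, f] / 2) by rewrite sqrtr_gt0 divr_gt0.
have [b Tb] := dense _ f20 _ e0.
have [b2 _] := TL2 _ Tb; have fb2 := Lfun2B f2 b2.
rewrite (Lnorm2E fb2) lte_fin ltr_sqrt ?divr_gt0// => fb.
have := L2_cauchy_schwarz fb2 f2.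
have -> : '[(fun x => f x - b x), f] = '[f, f].
  rewrite -[RHS]subr0 -(fT _ Tb) (L2ipC eta f b) -mulN1r -L2ip_linl//.
  by apply: eq_Rintegral => x _; rewrite mulN1r.
by rewrite expr2 ler_pM2r// => h; have := le_lt_trans h fb; lra.
Qed.

End tangent_space_theory.

(** * The score operator and the efficiency bound *)

Lemma has_law_distribution dO (Omega : measurableType dO) d
    (T : measurableType d) (R : realType) (Pr : probability Omega R)
    (X : {mfun Omega >-> T}) : has_law Pr X (distribution Pr X).
Proof. by []. Qed.

Section score_operator.
Context (R : realType) dO (Omega : measurableType dO)
  (Pr : probability Omega R) dZ (Zt : measurableType dZ).
Variables (Z : {mfun Omega >-> Zt}) (alpha : {mfun Omega >-> measurableTypeR R})
  (H : set (distr R)) (eta : distr R) (nu : probability Zt R).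
Hypotheses (Znu : has_law Pr Z nu) (aeta : has_law Pr alpha eta).

(* v is a version of E[b(alpha) | Z] lying in L2, pinned down by its pairings. *)
Definition L2_score (b : R -> R) (v : Zt -> R) : Prop :=
  v \in Lfun nu 2%:E /\ forall h, h \in Lfun nu 2%:E ->
    (\int[nu]_z (v z * h z) = \int[Pr]_w (h (Z w) * b (alpha w)))%R.

Lemma L2_score_operator b v : b \in Lfun eta 2%:E -> L2_score b v ->
  is_score_operator Pr Z alpha b v.
Proof.
move=> b2 [v2 vP]; have mv := Lfun2_measurable v2; split=> //.
  by apply: Lfun2_integrable; exact: (Lfun2_law Znu).
move=> B mB; have mZB : measurable (Z @^-1` B).
  exact: measurable_funPTI.
rewrite -(law_integral Znu mB mv) -Rintegral_mul_indic//; last first.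
  exact: Lfun2_integrable.
rewrite vP; last exact: Lfun2_indic.
rewrite -Rintegral_mul_indic//; last first.
  by apply: Lfun2_integrable; exact: (Lfun2_law aeta b2).
by congr EFin; apply: eq_Rintegral => w _; rewrite mulrC.
Qed.

(** Each tangent score enters the supremum through any L2 version of its image; clearing
    denominators yields the bound that [L2_riesz] asks for. *)
Lemma efficiency_bound_finite r :
  (efficiency_bound Pr Z alpha H eta r < +oo)%E ->
  tangent_space H eta `<=` [set b | b \in Lfun eta 2%:E] ->
  exists2 C, 0 <= C & forall b v, tangent_space H eta b -> L2_score b v ->
    (\int[eta]_a (r a * b a))%R ^+ 2 <= C * (\int[nu]_z (v z * v z))%R.
Proof.
move=> Moo TL2; set M := efficiency_bound _ _ _ _ _ _ in Moo.
exists (Num.max 0 (fine M)); first by rewrite le_max lexx.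
move=> b v Tb bv; have [v2 _] := bv; have mv := Lfun2_measurable v2.
have : (bound_ratio (((\int[eta]_a (r a * b a))%R ^+ 2)%R)%:E
    (\int[Pr]_w ((v (Z w)) ^+ 2)%:E) <= M)%E.
  apply: ereal_sup_ubound; exists b, v; split => //.
  by apply: L2_score_operator => //; exact: TL2.
have -> : (\int[Pr]_w ((v (Z w)) ^+ 2)%:E = (\int[nu]_z (v z * v z))%R%:E)%E.
  rewrite -L2sq_integral// (law_integral Znu) ?preimage_setT//.
  exact: measurable_funX.
rewrite /bound_ratio eqe.
have := L2ip_ge0 nu v; rewrite le_eqVlt => /predU1P[<-|q0].
  (* A zero denominator gives the ratio 0 or [+oo], and finiteness of [M] rules out the latter. *)
  rewrite eqxx mulr0; case: ifPn => [|_]; first by rewrite eqe => /eqP ->.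
  by rewrite leNgt Moo.
rewrite gt_eqF// inver gt_eqF// -EFinM => cM.
have Mfin : M \is a fin_num.
  by rewrite fin_numE (lt_eqF Moo) andbT gt_eqF// (lt_le_trans _ cM)// ltNyr.
rewrite -ler_pdivrMr//; move: cM; rewrite -(fineK Mfin) lee_fin => cM.
by rewrite le_max cM orbT.
Qed.

(** This solves the adjoint equation: [E[s(Z) | alpha]] and [r] have the same pairings with tangent
    scores. *)
Lemma L2_score_representer r : r \in Lfun eta 2%:E ->
  (efficiency_bound Pr Z alpha H eta r < +oo)%E ->
  tangent_space H eta `<=` L2_0 eta ->
  exists2 s, L2_0 nu s & forall b, tangent_space H eta b ->
    (\int[Pr]_w (s (Z w) * b (alpha w)) = \int[eta]_a (r a * b a))%R.
Proof.
move=> r2 Moo TL20; have TL2 b : tangent_space H eta b -> b \in Lfun eta 2%:E.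
  by move=> /TL20[].
have [C C0 effC] := efficiency_bound_finite Moo TL2.
(* A relation, since different [b] may share [v]; the bound [effC] is what makes [c] depend on [v]
   alone. *)
pose G v c := exists b, [/\ tangent_space H eta b, L2_score b v &
  c = (\int[eta]_a (r a * b a))%R].
have [|||||s s2 sP] := @L2_riesz _ _ _ nu G C.
- exact: C0.
- by move=> v c [b [_ []]].
- exists (cst 0); split; first exact: tangent_space0.
    split; first exact: Lfun2_cst.
    move=> h h2; rewrite [LHS](_ : _ = 0).
      by under eq_Rintegral do rewrite mulr0; rewrite Rintegral_cst// mul0r.
    by under eq_Rintegral do rewrite mul0r; rewrite Rintegral_cst// mul0r.
  by under eq_Rintegral do rewrite mulr0; rewrite Rintegral_cst// mul0r.
- move=> v c w e k [b [Tb [v2 vP] ->]] [b' [Tb' [w2 wP] ->]].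
  exists (fun x => b x + k * b' x); split; first exact: tangent_space_lin.
    split; first exact: Lfun2_lin.
    move=> h h2; rewrite L2ip_linl// vP// wP//.
    have hZ2 := Lfun2_law Znu h2.
    have ba2 := Lfun2_law aeta (TL2 _ Tb).
    have b'a2 := Lfun2_law aeta (TL2 _ Tb').
    rewrite (L2ipC Pr (h \o Z) (b \o alpha)) (L2ipC Pr (h \o Z) (b' \o alpha)).
    by rewrite -L2ip_linl//; apply: eq_Rintegral => x _; rewrite mulrC.
  by rewrite !(L2ipC eta r) L2ip_linl//; exact: TL2.
- by move=> v c [b [Tb bv ->]]; exact: effC.
(* Recentring places the representer in [L2_0 nu]; the pairings survive because tangent scores have
   mean zero. *)
pose m := (\int[nu]_z s z)%R.
have s'2 : (fun z => s z - m) \in Lfun nu 2%:E.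
  exact: Lfun2B (Lfun2_cst nu m).
have sb b : tangent_space H eta b ->
    (\int[Pr]_w (s (Z w) * b (alpha w)) = \int[eta]_a (r a * b a))%R.
  move=> Tb; have [v v2 vP] := condexp_L2 Znu aeta (TL2 _ Tb).
  by rewrite -vP// L2ipC; apply: sP; exists b.
exists (fun z => s z - m).
  split=> //; rewrite RintegralB//; [|exact: Lfun2_integrable|].
    rewrite Rintegral_cst//= (_ : nu setT = 1%E) ?mulr1 ?subrr//.
    exact: probability_setT.
  exact: (Lfun2_integrable (Lfun2_cst nu m)).
move=> b Tb; rewrite -sb//; have [b2 b0] := TL20 _ Tb.
have bP2 := Lfun2_law aeta b2; have sP2 := Lfun2_law Znu s2.
transitivity (\int[Pr]_w ((s \o Z) w * (b \o alpha) w) +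
    (- m) * \int[Pr]_w (cst 1 w * (b \o alpha) w))%R.
  rewrite -L2ip_linl//; last exact: Lfun2_cst.
  by apply: eq_Rintegral => w _; rewrite /= mulr1.
rewrite [X in _ * X](_ : _ = 0) ?mulr0 ?addr0//.
rewrite -b0 (law_Rintegral aeta); last exact: Lfun2_measurable b2.
by apply: eq_Rintegral => w _; rewrite /= mul1r.
Qed.

End score_operator.

(** * The contradiction at the quantile *)

Lemma ae_imp3 d (T : measurableType d) (R : realType)
    (nu : probability T R) (P1 P2 P3 Q : T -> Prop) :
  {ae nu, forall x, P1 x} -> {ae nu, forall x, P2 x} ->
  {ae nu, forall x, P3 x} -> (forall x, P1 x -> P2 x -> P3 x -> Q x) ->
  {ae nu, forall x, Q x}.
Proof. by move=> h1 h2 h3 h; move: h1 h2 h3; apply: filterS3. Qed.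

Theorem corollary3p2 (R : realType)
  (dO : measure_display) (Omega : measurableType dO) (Pr : probability Omega R)
  (dZ : measure_display) (Zt : measurableType dZ)
  (mu : {sigma_finite_measure set Zt -> \bar R})
  (Z : {mfun Omega >-> Zt}) (alpha : {mfun Omega >-> measurableTypeR R})
  (f : Zt -> R -> R) (H : set (distr R)) (eta0 : distr R) (A : set R)
  (hA : A = msupport eta0)
  (hH : forall eta, H eta -> eta A = 1%E)
  (heta0 : H eta0)
  (hf : cond_density mu f A)
  (hmodel : uh_model Pr Z alpha mu f A eta0)
  (hnonpar : nonparametric H eta0)
  (tau : R) (htau : 0 < tau < 1)
  (hquantile : eta0 [set` `]-oo, quantile tau eta0]] = tau%:E)
  (p : R -> R)
  (hdensity : exists U : set R,
    [/\ open U, U (quantile tau eta0), (forall a, U a -> 0 < p a) &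
        is_density (@lebesgue_measure R) p eta0 U])
  (hgradient : is_gradient H eta0 (quantile tau)
    (quantile_gradient tau (quantile tau eta0) p))
  (N : set R) (hNopen : open N) (hNA : N `<=` A)
  (hcont : {ae mu, forall z, {within N, continuous (f z)}})
  (hdom : forall a, N a -> exists Gamma0 : set R,
    [/\ nbhs a Gamma0, Gamma0 `<=` N &
      forall s : Zt -> R, L2_0 (distribution Pr Z) s ->
        {ae eta0, forall a',
          (quantile_gradient tau (quantile tau eta0) p a')%:E =
            (\int[mu]_z (s z * f z a')%:E)%E} ->
        (\int[mu]_z (`|s z|%:E *
           ereal_sup [set (f z a')%:E | a' in Gamma0]) < +oo)%E])
  (hN : N (quantile tau eta0)) :
  ~ regularly_identified Pr Z alpha mu f A H eta0 (quantile tau).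
Proof.
move=> [_ [r r_grad Moo]].
have [r2 _] := r_grad.1; have [rq2 rq0] := hgradient.1.
have [TL20 _] := hnonpar.
have [alpha_law XY] := hmodel.
have aeta : has_law Pr alpha eta0 by [].
have Znu := has_law_distribution Pr Z.
have mA : measurable (A : set (measurableTypeR R)).
  by rewrite hA; apply: closed_measurable; exact: closed_msupport.
have [mf0 f_ge0 _] := hf.
set q := quantile tau eta0 in hquantile hdensity hgradient rq2 rq0 hdom hN *.
set rq := quantile_gradient tau q p in hgradient rq2 rq0 hdom.
(* The density is controlled only for [a] in [A]. Extending it by zero gives a globally measurable
   nonnegative function, and [A] has full [eta0]-mass. *)
pose F : Zt * measurableTypeR R -> R :=
  (fun u => f u.1 u.2) \_ ([set: Zt] `*` A).
have mF : measurable_fun setT F.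
  by apply/(measurable_restrictT _ _).1 => //; exact: measurableX.
have FA z a : A a -> F (z, a) = f z a.
  by move=> Aa; rewrite /F patchE mem_set.
have F0 u : 0 <= F u.
  rewrite /F patchE; case: ifPn => // /set_mem[_ Au]; exact: f_ge0.
have FXY B C : measurable B -> measurable C ->
    Pr (Z @^-1` B `&` alpha @^-1` C) =
    (\int[eta0]_(y in C) \int[mu]_(x in B) (F (x, y))%:E)%E.
  move=> mB mC; rewrite XY// setIC integral_mkcondr.
  apply: eq_integral => a _; rewrite patchE; case: ifPn => [/set_mem Aa|aA].
    by apply: eq_integral => z _; rewrite FA.
  rewrite integral0_eq// => z _; rewrite /F patchE memNset// => -[_].
  by move/mem_set; rewrite (negPf aA).
have [s s20 sP] := L2_score_representer Znu aeta r2 Moo TL20.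
have [s2 s0] := s20; have ms := Lfun2_measurable s2.
have [k k2 kP] := condexp_L2 aeta Znu s2.
have kb b : b \in Lfun eta0 2%:E ->
    (\int[eta0]_a (k a * b a) = \int[Pr]_w (s (Z w) * b (alpha w)))%R.
  by move=> b2; rewrite kP//; apply: eq_Rintegral => w _; rewrite mulrC.
(* Both functions are centred, and for tangent [b] the pairings of [k], of [r] and of [rq] coincide,
   so the difference is orthogonal to a dense set. *)
have rqk : {ae eta0, forall a, rq a - k a = 0}.
  apply: (nonparametric_orthogonal hnonpar).
    split; first exact: Lfun2B.
    rewrite RintegralB//; [|exact: Lfun2_integrable|exact: Lfun2_integrable].
    rewrite rq0 sub0r [X in - X](_ : _ = 0) ?oppr0//.
    have -> : (\int[eta0]_a k a = \int[eta0]_a (k a * cst 1 a))%R.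
      by apply: eq_Rintegral => a _; rewrite /= mulr1.
    rewrite kb ?Lfun2_cst// -[RHS]s0 (law_Rintegral Znu ms).
    by apply: eq_Rintegral => w _; rewrite /= mulr1.
  move=> b Tb; have [b2 _] := TL20 _ Tb.
  have -> : (\int[eta0]_x ((rq x - k x) * b x) =
      \int[eta0]_x ((fun x => rq x + (-1) * k x) x * b x))%R.
    by apply: eq_Rintegral => x _; rewrite mulN1r.
  rewrite L2ip_linl// kb// sP// (gradient_unique hgradient r_grad Tb).
  by rewrite mulN1r subrr.
have kF := condexp_density mF F0 FXY ms (Lfun2_law Znu s2) k2 kP.
have aeA : {ae eta0, forall a, A a}.
  exists (~` A); split => //; first exact: measurableC.
  by rewrite probability_setC// hH// subee.
have rqF : {ae eta0, forall a, (rq a)%:E = \int[mu]_z (s z * f z a)%:E}%E.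
  apply: (ae_imp3 aeA rqk kF) => a Aa /eqP; rewrite subr_eq0 => /eqP -> ->.
  by apply: eq_integral => z _; rewrite FA.
have [G [nG GN Gfin]] := hdom q hN.
(* The domination hypothesis becomes available only now, once [s] is centred and solves the integral
   equation. *)
have sG := Gfin s s20 rqF.
have mfN a : N a -> measurable_fun setT (f^~ a).
  move=> Na; rewrite (_ : f^~ a = fun z => F (z, a)).
    exact: measurable_fun_pair1.
  by apply/funext => z; rewrite FA//; exact: hNA.
have fN0 z a : N a -> 0 <= f z a by move=> Na; apply: f_ge0; exact: hNA.
have NS : N `<=` msupport eta0 by rewrite -hA.
have /nbhs_ballP[e /= e0 eG] := nG.
have [W [_ Wq p_gt0 _]] := hdensity; have {W Wq p_gt0}pq0 := p_gt0 _ Wq.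
have ed0 n : 0 < e / n.+1%:R by rewrite divr_gt0.
have edle n : e / n.+1%:R <= e by rewrite ler_pdivrMr// ler_peMr ?ler1n// ltW.
have lc c (U : nat -> set R) := @locally_constant_limit R _ Zt mu f N G q s eta0
  rq c e U mfN fN0 hNopen hcont nG GN ms sG NS rqF.
(* To the left of [q] the indicator in the gradient is 1, to the right it is 0; radii [e / n.+1]
   keep the intervals inside [G]. *)
have left_lim : ((tau - 1) / p q)%:E = (\int[mu]_z (s z * f z q)%:E)%E.
  apply: (lc _ (fun n => `]q - e / n.+1%:R, q[%classic)).
  - by move=> n; exact: interval_open.
  - move=> n; exists (q - e / n.+1%:R / 2); rewrite /= in_itv/=.
    by have := ed0 n; set x := e / _ => x0; apply/andP; split; lra.
  - move=> n a; rewrite ball_itv /= !in_itv/= => /andP[-> /lt_trans]; apply.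
    by rewrite ltrDl.
  - move=> n a; rewrite /= in_itv/= => /andP[h1 h2]; apply: eG.
    rewrite ball_itv /= in_itv/=; have := edle n; have := e0.
    move: h1; set x := e / _ => h1 ? ?; apply/andP; split; lra.
  - move=> n a; rewrite /= in_itv/= => /andP[_ aq].
    by rewrite /rq /quantile_gradient aq opprB.
have right_lim : (tau / p q)%:E = (\int[mu]_z (s z * f z q)%:E)%E.
  apply: (lc _ (fun n => `]q, q + e / n.+1%:R[%classic)).
  - by move=> n; exact: interval_open.
  - move=> n; exists (q + e / n.+1%:R / 2); rewrite /= in_itv/=.
    by have := ed0 n; set x := e / _ => x0; apply/andP; split; lra.
  - move=> n a; rewrite ball_itv /= !in_itv/= => /andP[qa ->]; rewrite andbT.
    by apply: lt_trans qa; rewrite ltrBlDr ltrDl.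
  - move=> n a; rewrite /= in_itv/= => /andP[h1 h2]; apply: eG.
    rewrite ball_itv /= in_itv/=; have := edle n; have := e0.
    move: h2; set x := e / _ => h2 ? ?; apply/andP; split; lra.
  - move=> n a; rewrite /= in_itv/= => /andP[qa _].
    by rewrite /rq /quantile_gradient ltNge (ltW qa)/= sub0r opprK.
(* Both one-sided values equal the integral at [q]; multiplying by the positive [p q] leaves
   [tau = tau - 1]. *)
have := right_lim; rewrite -left_lim => -[] /(congr1 ( *%R^~ (p q))).
rewrite !divfK ?gt_eqF// => /eqP.
by rewrite -subr_eq0 opprB addrCA subrr addr0 oner_eq0.
Qed.
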